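(* Let $G$ be a random probability measure on the unit ball of a separable Hilbert space $H$ that satisfies the Ghirlanda-Guerra identities: for any $n\ge 2$, any bounded measurable function $f$ of the overlaps $(R_{l,l'})_{l,l'\le n}$ and any bounded measurable function $\psi:\mathbb{R}\to\mathbb{R}$ of one overlap, $$\mathbb{E}\bigl\langle f\,\psi(R_{1,n+1})\bigr\rangle=\frac1n\,\mathbb{E}\langle f\rangle\,\mathbb{E}\langle\psi(R_{1,2})\rangle+\frac1n\sum_{l=2}^n\mathbb{E}\bigl\langle f\,\psi(R_{1,l})\bigr\rangle .$$ Then the distribution of $(R_{l,l'})_{l,l'\ge1}$ is ultrametric, i.e. $$\mathbb{E}\bigl\langle I\bigl(R_{1,2}\ge\min(R_{1,3},R_{2,3})\bigr)\bigr\rangle=1 .$$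
   Context: Here $(\sigma^l)_{l\ge1}$ is an i.i.d. sample from $G$ (given $G$), $\langle\cdot\rangle$ denotes the average with respect to $G^{\otimes\infty}$, $\mathbb{E}$ denotes the expectation with respect to the randomness of $G$, and $R_{l,l'}=\sigma^l\cdot\sigma^{l'}$ is the scalar product (overlap) of $\sigma^l$ and $\sigma^{l'}$ in $H$ (including the diagonal $l=l'$). $I(\cdot)$ denotes the indicator of an event. *)

(* Defs.v *)
From HB Require Import structures.
From mathcomp Require Import all_boot all_order all_algebra.
From mathcomp Require Import all_classical all_reals all_analysis.
From mathcomp Require Import measurable_realfun.

Set Implicit Arguments.
Unset Strict Implicit.
Unset Printing Implicit Defensive.

Import Order.TTheory GRing.Theory Num.Theory.
Import numFieldNormedType.Exports.

Local Open Scope classical_set_scope.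
Local Open Scope ring_scope.

(* seqspace T is T^nat with the product sigma-algebra, generated by the
   coordinate projections. *)
Definition coord_sets {d} (T : measurableType d) : set (set (nat -> T)) :=
  [set A | exists i (B : set T), measurable B /\ A = [set s | B (s i)]].

Notation seqspace T := (g_sigma_algebraType (@coord_sets _ T)).

(* The measure mu^{(x) oo} on seqspace T. MathComp-Analysis has no infinite
   product measures, so its existence is proved here for an arbitrary measurable
   space T: the finite powers fpow n induce a content on the algebra of
   cylinders; it is sigma-subadditive by the Ionescu-Tulcea argument (if
   mu A > \sum_k mu (F k), then this persists for the sections at some first
   coordinate t, hence along some sequence t0, t1, ...), and it extends to
   the generated sigma-algebra by the Caratheodory theorem. The only properties
   to retain are infinite_power and infinite_powerE; the latter determines the
   former, since finite rectangles are a pi-system that generates the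
   sigma-algebra. *)
Section infinite_power.
Context d (T : measurableType d) (R : realType) (mu : probability T R).
Local Open Scope ereal_scope.
Local Notation S := (seqspace T).

Definition scons (t : T) (s : S) : S :=
  fun i => if i is j.+1 then s j else t.

Lemma measurable_coord i : measurable_fun setT (fun s : S => s i).
Proof.
move=> _ B mB; rewrite setTI; apply: sub_sigma_algebra.
by exists i, B.
Qed.

Lemma measurable_to_seq d' (X : measurableType d') (f : X -> S) :
  (forall i, measurable_fun setT (fun x => f x i)) -> measurable_fun setT f.
Proof.
move=> mf.
apply: (@measurability _ _ X S setT f (@coord_sets _ T)) => //.
move=> _ [_ [i [B [mB ->]] <-]].
exact: (mf i measurableT B mB).
Qed.

Lemma measurable_scons : measurable_fun setT (fun p : T * S => scons p.1 p.2).
Proof.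
apply: measurable_to_seq => -[|i] /=; first exact: measurable_fst.
exact: measurableT_comp (measurable_coord i) measurable_snd.
Qed.

Lemma measurable_scons1 t : measurable_fun setT (scons t).
Proof.
apply: measurable_to_seq => -[|i] /=; first exact: measurable_cst.
exact: measurable_coord.
Qed.


Let sconsp (p : T * S) : S := scons p.1 p.2.
HB.instance Definition _ := isMeasurableFun.Build _ _ _ _ sconsp measurable_scons.

Definition pcons (P : probability S R) : probability S R :=
  distribution (mu \x P)%E sconsp.

Lemma pconsE P A : pcons P A = \int[mu]_t P (scons t @^-1` A).
Proof.
apply: eq_integral => t _ /=; congr (P _).
by apply/seteqP; split => s /=; rewrite /xsection/= inE.
Qed.

(* The law of (t_0, ..., t_(n-1), point, point, ...) with t_i i.i.d. of law mu. *)
Fixpoint fpow n : probability S R :=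
  if n is m.+1 then pcons (fpow m) else \d_(point : S).

Definition determined n (A : set S) :=
  forall s t : S, (forall i, (i < n)%N -> s i = t i) -> A s -> A t.

Lemma determinedW n m A : (n <= m)%N -> determined n A -> determined m A.
Proof.
by move=> nm dA s t st; apply: dA => i /leq_trans; move/(_ _ nm); exact: st.
Qed.

Lemma determined_scons n t A :
  determined n A -> determined n.-1 (scons t @^-1` A).
Proof.
move=> dA s s' ss'; apply: dA => -[|i]//= i_n; apply: ss'.
by rewrite ltn_predRL.
Qed.

Lemma determined0 A s : determined 0 A -> A s -> A = setT.
Proof. by move=> dA As; apply/seteqP; split=> // t _; exact: dA As. Qed.

Lemma fpow_determined n m A : (n <= m)%N -> determined n A ->
  fpow m A = fpow n A.
Proof.
elim: n m A => [|n IHn] m A nm dA.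
  have [[s As]|A0] := pselect (A !=set0).
    by rewrite (determined0 dA As) !probability_setT.
  suff -> : A = set0 by rewrite !measure0.
  by apply/seteqP; split => // s As; apply: A0; exists s.
case: m nm => // m nm; rewrite [LHS]pconsE [RHS]pconsE.
by apply: eq_integral => t _; apply: IHn => //; exact: determined_scons dA.
Qed.

Definition cylinder : set (set S) :=
  [set A | measurable A /\ exists n, determined n A].

Definition cylinder_type : Type := S.
HB.instance Definition _ := Pointed.on cylinder_type.

Let cylinder0 : cylinder set0.
Proof. by split=> //; exists 0%N. Qed.

Let cylinderU : setU_closed cylinder.
Proof.
move=> A B [mA [n dA]] [mB [m dB]]; split; first exact: measurableU.
exists (maxn n m) => s t st [As|Bs]; [left|right].
  exact: (determinedW (leq_maxl n m) dA st As).
exact: (determinedW (leq_maxr n m) dB st Bs).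
Qed.

Let cylinderC : setC_closed cylinder.
Proof.
move=> A [mA [n dA]]; split; first exact: measurableC.
by exists n => s t st As At; apply: As; apply: dA At => i i_n; rewrite st.
Qed.

HB.instance Definition _ := @isAlgebraOfSets.Build default_measure_display
  cylinder_type cylinder cylinder0 cylinderU cylinderC.

Lemma cylinder_scons t (A : set S) : cylinder A -> cylinder (scons t @^-1` A).
Proof.
move=> [mA [n dA]]; split; last by exists n.-1; exact: determined_scons.
by rewrite -[X in measurable X]setTI; exact: measurable_scons1.
Qed.

Definition cyl_content (A : set cylinder_type) : \bar R :=
  fpow (get [set n | determined n A]) A.

Lemma cyl_contentE n (A : set S) : determined n A -> cyl_content A = fpow n A.
Proof.
move=> dA; rewrite /cyl_content; set k := get _.
have dkA : determined k A by apply: (@getPex _ [set n | determined n A]); exists n.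
by have [kn|/ltnW nk] := leqP k n; [rewrite (fpow_determined kn)
  |rewrite -(fpow_determined nk)].
Qed.

Let cyl_content_ge0 A : 0 <= cyl_content A.
Proof. exact: measure_ge0. Qed.

Let cyl_content_additive : measure_function.semi_additive cyl_content.
Proof.
move=> F n mF tF mUF.
have /choice[m dF] i := (mF i).2.
pose M := (\max_(i < n) m i)%N.
have dFM i : (i < n)%N -> determined M (F i).
  move=> i_n; apply: determinedW (dF i).
  by rewrite (leq_trans _ (leq_bigmax (Ordinal i_n))).
have dU : determined M (\big[setU/set0]_(i < n) F i).
  move=> s t st; rewrite -!bigcup_mkord => -[i i_n Fis]; exists i => //.
  exact: dFM Fis.
rewrite (cyl_contentE dU) measure_bigsetU//; last by move=> i; exact: (mF i).1.
by apply: eq_bigr => i _; rewrite (cyl_contentE (dFM i (ltn_ord i))).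
Qed.

HB.instance Definition _ := isContent.Build _ cylinder_type R cyl_content
  cyl_content_ge0 cyl_content_additive.

Lemma cyl_content_scons (A : set S) : cylinder A ->
  cyl_content A = \int[mu]_t cyl_content (scons t @^-1` A).
Proof.
move=> [mA [n dA]].
rewrite (cyl_contentE (determinedW (leqnSn n) dA)) [LHS]pconsE.
apply: eq_integral => t _; rewrite (@cyl_contentE n)//.
by apply: determinedW (determined_scons dA); exact: leq_pred.
Qed.

Lemma measurable_cyl_content_scons (A : set S) : cylinder A ->
  measurable_fun [set: T] (fun t => cyl_content (scons t @^-1` A) : \bar R).
Proof.
move=> [mA [n dA]].
rewrite (_ : (fun _ => _) = fpow n \o xsection (sconsp @^-1` A)).
  apply: measurable_fun_xsection.
  by rewrite -[X in measurable X]setTI; exact: measurable_scons.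
apply/funext => t /=; rewrite (@cyl_contentE n).
  by congr (fpow n _); apply/seteqP; split => s /=; rewrite /xsection/= inE.
by apply: determinedW (determined_scons dA); exact: leq_pred.
Qed.

Let bad (AF : set S * (set S)^nat) :=
  \sum_(k <oo) cyl_content (AF.2 k) < cyl_content AF.1.

Let sec t (AF : set S * (set S)^nat) : set S * (set S)^nat :=
  (scons t @^-1` AF.1, fun k => scons t @^-1` AF.2 k).

Let bad_sec AF : cylinder AF.1 -> (forall k, cylinder (AF.2 k)) -> bad AF ->
  exists t, bad (sec t AF).
Proof.
move=> cA cF; apply: contraPP => /forallNP good; apply/negP.
rewrite -leNgt (cyl_content_scons cA).
under eq_eseriesr do rewrite cyl_content_scons//.
rewrite -integral_nneseries//; last first.
  by move=> k; exact: measurable_cyl_content_scons.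
apply: ge0_le_integral => //.
- exact: measurable_cyl_content_scons.
- apply: ge0_emeasurable_sum => // k _; exact: measurable_cyl_content_scons.
- by move=> t _; have /negP := good t; rewrite /bad/= -leNgt.
Qed.

Lemma cyl_content_sigma_subadditive :
  measurable_subset_sigma_subadditive cyl_content.
Proof.
move=> A F cF cA AF; rewrite leNgt; apply/negP => badAF.
pose next X := get [set t | bad (sec t X)].
pose st := fix st m := if m is k.+1 then sec (next (st k)) (st k) else (A, F).
have stP m : [/\ cylinder (st m).1, forall k, cylinder ((st m).2 k) &
                 bad (st m)].
  elim: m => [//|m [cAm cFm bm]] /=; split.
  - exact: cylinder_scons.
  - by move=> k; exact: cylinder_scons.
  - exact: (getPex (bad_sec cAm cFm bm)).
pose x (i : nat) := next (st i).
pose tail m : S := fun i => x (m + i)%N.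
have tailS m : scons (x m) (tail m.+1) = tail m.
  by apply/funext => -[|i]/=; rewrite /tail ?addn0// addSnnS.
have stA m : (st m).1 (tail m) = A x.
  by elim: m => [//|m <-] /=; rewrite -/(x m) tailS.
have stF m k : (st m).2 k (tail m) = F k x.
  by elim: m => [//|m <-] /=; rewrite -/(x m) tailS.
have detA n m : determined n A -> determined (n - m) (st m).1.
  move=> dA; elim: m => [|m IH] /=; first by rewrite subn0.
  by rewrite subnS; exact: determined_scons.
have detF n m k : determined n (F k) -> determined (n - m) ((st m).2 k).
  move=> dF; elim: m => [|m IH] /=; first by rewrite subn0.
  by rewrite subnS; exact: determined_scons.
have contentT : cyl_content setT = 1 by exact: probability_setT.
have Ax : A x.
  have [_ [n dA]] := cA; have [_ _ bn] := stP n.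
  have : determined 0 (st n).1 by rewrite -(subnn n); exact: detA.
  have [[s As] dn|A0 _] := pselect ((st n).1 !=set0).
    by rewrite -(stA n) (determined0 dn As).
  exfalso; move: bn; rewrite /bad.
  have -> : (st n).1 = set0 by apply/seteqP; split=> // s ?; apply: A0; exists s.
  rewrite measure0; apply/negP; rewrite -leNgt; exact: nneseries_ge0.
have [k _ Fkx] := AF _ Ax.
have [_ [n dF]] := cF k; have [[mAn [p dAn]] _ bn] := stP n.
have dn : determined 0 ((st n).2 k) by rewrite -(subnn n); exact: detF.
have FT : (st n).2 k = setT by apply: (@determined0 _ (tail n)) => //; rewrite stF.
move: bn; rewrite /bad; apply/negP; rewrite -leNgt.
apply: (@le_trans _ _ 1).
  by rewrite (cyl_contentE dAn) probability_le1.
rewrite (@nneseriesD1 R (fun k => cyl_content ((st n).2 k)) k)//.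
by rewrite FT contentT leeDl//; exact: nneseries_ge0.
Qed.

HB.instance Definition _ := Content_SigmaSubAdditive_isMeasure.Build _ R
  cylinder_type cyl_content cyl_content_sigma_subadditive.

Lemma coord_cylinder (A : set S) : @coord_sets _ T A -> cylinder A.
Proof.
move=> [i [B [mB ->]]]; split.
  by apply: sub_sigma_algebra; exists i, B.
by exists i.+1 => s t st /=; rewrite st.
Qed.

Let ext_type := g_sigma_algebraType (@measurable _ cylinder_type).
Let of_ext (s : ext_type) : S := s.

Let measurable_of_ext : measurable_fun [set: ext_type] of_ext.
Proof.
apply: (@measurability _ _ ext_type S setT of_ext (@coord_sets _ T)) => //.
move=> _ [B cB <-]; rewrite setTI; apply: sub_sigma_algebra.
exact: coord_cylinder.
Qed.
HB.instance Definition _ :=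
  isMeasurableFun.Build _ _ _ _ of_ext measurable_of_ext.

Let ext_setT : measure_extension cyl_content [set: ext_type] = 1.
Proof.
rewrite /measure_extension measurable_mu_extE; first exact: probability_setT.
exact: (@measurableT _ cylinder_type).
Qed.
HB.instance Definition _ := Measure_isProbability.Build _ _ _
  (measure_extension cyl_content) ext_setT.

Lemma fpow_prod n (B : (set T)^nat) : (forall i, measurable (B i)) ->
  fpow n [set s | forall i, (i < n)%N -> B i (s i)] =
  \prod_(i < n) mu (B i).
Proof.
elim: n B => [|n IHn] B mB.
  by rewrite big_ord0 (_ : [set _ | _] = setT) ?probability_setT//; apply/seteqP.
rewrite [LHS]pconsE big_ord_recl.
rewrite (eq_integral (fun t => (\1_(B 0%N) t)%:E *
    \prod_(i < n) mu (B i.+1))); last first.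
  move=> t _; rewrite indicE.
  rewrite -(IHn (fun i => B i.+1) (fun i => mB i.+1)).
  have [/set_mem Bt|/negP Bt] := boolP (t \in B 0%N).
    rewrite mul1e; congr (fpow n _); apply/seteqP; split => s /= Bs.
      by move=> i i_n; exact: (Bs i.+1).
    by case=> [|i]//= i_n; exact: Bs.
  rewrite mul0e (_ : _ @^-1` _ = set0) ?measure0//.
  apply/seteqP; split => // s /(_ 0%N isT) B0; exfalso; apply: Bt.
  exact: mem_set.
rewrite -(IHn (fun i => B i.+1) (fun i => mB i.+1)).
rewrite ge0_integralZr//; last first.
  by apply/measurable_EFinP; exact: measurable_indic.
by rewrite integral_indic// setIT.
Qed.

Lemma infinite_power_exists : exists P : probability S R,
  forall n (B : (set T)^nat), (forall i, measurable (B i)) ->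
  P [set s | forall i, (i < n)%N -> B i (s i)] = \prod_(i < n) mu (B i).
Proof.
exists (distribution (measure_extension cyl_content) of_ext) => n B mB.
rewrite /distribution/pushforward/=.
have dB : determined n [set s | forall i, (i < n)%N -> B i (s i)].
  by move=> s t st /= Bs i i_n; rewrite -st//; exact: Bs.
have cB : cylinder [set s | forall i, (i < n)%N -> B i (s i)].
  split; last by exists n.
  rewrite (_ : [set _ | _] = \bigcap_(i in `I_n) [set s | B i (s i)]).
    apply: fin_bigcap_measurable => // i _.
    by apply: sub_sigma_algebra; exists i, (B i).
  by apply/seteqP; split.
by rewrite [LHS]measurable_mu_extE// -fpow_prod//; exact: cyl_contentE dB.
Qed.

Definition infinite_power : probability S R := sval (cid infinite_power_exists).

Lemma infinite_powerE n (B : (set T)^nat) : (forall i, measurable (B i)) ->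
  infinite_power [set s | forall i, (i < n)%N -> B i (s i)] =
  \prod_(i < n) mu (B i).
Proof. exact: (svalP (cid infinite_power_exists)). Qed.

End infinite_power.

Definition separable (X : topologicalType) :=
  exists2 D : set X, countable D & dense D.

Notation borel X := (g_sigma_algebraType (@open X)).

(* A random probability measure on H is a random variable G with values in
   pprobability (borel H) R, i.e. w |-> G w A is measurable for every Borel
   set A. Replicas are numbered from 0, so R_{l,l'} is overlap sigma (l-1) (l'-1). *)
Section replicas.
Context d (Omega : measurableType d) (R : realType) (P : probability Omega R).
Context (H : completeNormedModType R) (dot : {dot H for idfun}).
Context (G : {mfun Omega >-> pprobability (borel H) R}).

Definition overlap (sigma : nat -> H) (l l' : nat) : R :=
  dot (sigma l) (sigma l').

(* Nested tuples carry the product sigma-algebra, which on n x n real arrays is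
   the Borel one. *)
Definition overlaps n (sigma : nat -> H) : n.-tuple (n.-tuple R) :=
  [tuple [tuple overlap sigma l l' | l' < n] | l < n].

(* E <F>, where <.> is the average with respect to the infinite power of G w. *)
Definition replica_avg (F : (nat -> H) -> R) : R :=
  \int[P]_w \int[infinite_power (G w)]_sigma F sigma.

Definition ghirlanda_guerra : Prop :=
  forall (n : nat) (f : n.-tuple (n.-tuple R) -> R) (psi : R -> R),
  (2 <= n)%N ->
  measurable_fun [set: n.-tuple (n.-tuple R)] f -> bounded_fun f ->
  measurable_fun [set: R] psi -> bounded_fun psi ->
  replica_avg (fun s => f (overlaps n s) * psi (overlap s 0 n)) =
    n%:R^-1 * replica_avg (fun s => f (overlaps n s)) *
      replica_avg (fun s => psi (overlap s 0 1)) +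
    n%:R^-1 * \sum_(1 <= l < n)
      replica_avg (fun s => f (overlaps n s) * psi (overlap s 0 l)).

End replicas.

(* Main.v *)
(* Duplication.  Let A be an event on n >= 2 replicas such that R_{1,l} < theta
   on A for 2 <= l <= n.  The Ghirlanda-Guerra identities give
     (n + k) b_{k+1} = (n - 1 + k + P(R_{1,2} < theta)) b_k
   for the probability b_k of A together with k further replicas that all have
   overlap < theta with the first one, hence b_k >= b_0 (n - 1) / (n + k - 1)
   and the series of the b_k diverges unless P(A) = 0.  If almost surely no
   replica that can replace the first one in A had overlap < theta with it,
   then b_k would be at most the probability that the first replica satisfies A
   and the k further ones do not; by exchangeability this is the probability
   that the first success in an exchangeable sequence occurs at the (k+1)-st
   trial, and these probabilities sum to at most 1.  So, with positive
   probability, the first replica has a duplicate with overlap < theta.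

   Barycenters.  If R_{1,2} < min(R_{1,3}, R_{2,3}) had positive probability,
   localize R_{1,2} < a < b <= R_{1,3} < b + e and b <= c <= R_{2,3} < c + e, and
   duplicate each of the three replicas m times.  Two replicas of the second (or
   of the third) cluster have overlap < c + e, so the barycenters V and W of
   these clusters satisfy |V - W|^2 = O(1/m + e), which is incompatible with
   U.(W - V) >= b - a for the barycenter U of the first cluster. *)
Require Import Defs.
From HB Require Import structures.
From mathcomp Require Import all_boot all_order all_algebra.
From mathcomp Require Import all_classical all_reals all_analysis.
From mathcomp Require Import measurable_realfun.
From mathcomp Require Import lra ring zify.

Import Order.TTheory GRing.Theory Num.Theory.
Import numFieldNormedType.Exports.

Local Open Scope classical_set_scope.
Local Open Scope ring_scope.

Set Implicit Arguments.
Unset Strict Implicit.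
Unset Printing Implicit Defensive.

(** * The averaged law of the replicas *)

(** Exchangeability of the replicas is needed only for transpositions of two indices. *)
Definition transp (a b i : nat) : nat :=
  if i == a then b else if i == b then a else i.

Lemma transpL a b : transp a b a = b.
Proof. by rewrite /transp eqxx. Qed.

Lemma transpR a b : transp a b b = a.
Proof. by rewrite /transp eqxx; case: eqVneq. Qed.

Lemma transpD a b i : i != a -> i != b -> transp a b i = i.
Proof. by rewrite /transp => /negPf-> /negPf->. Qed.

Lemma transpK a b : involutive (transp a b).
Proof.
move=> i; have [->|ia] := eqVneq i a; first by rewrite transpL transpR.
have [->|ib] := eqVneq i b; first by rewrite transpR transpL.
by rewrite !transpD.
Qed.

Lemma transp_inj a b : injective (transp a b).
Proof. exact: inv_inj (transpK a b). Qed.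

Lemma transp_lt a b n i : (a < n)%N -> (b < n)%N -> (i < n)%N ->
  (transp a b i < n)%N.
Proof. by rewrite /transp; case: ifP => // _; case: ifP. Qed.

Section rectangles.
Context d (T : measurableType d).
Local Notation S := (seqspace T).

Definition rectangle n (B : (set T)^nat) : set S :=
  [set s | forall i, (i < n)%N -> B i (s i)].

Definition rectangles : set (set S) :=
  [set A | exists n B, (forall i, measurable (B i)) /\ A = rectangle n B].

Lemma rectangle_widen n m (B : (set T)^nat) : (n <= m)%N ->
  rectangle n B = rectangle m (fun i => if (i < n)%N then B i else setT).
Proof.
move=> nm; apply/seteqP; split => s sB i i_m /=.
  by case: ifP => // /sB.
by have := sB i (leq_trans i_m nm); rewrite i_m.
Qed.

Lemma measurable_rectangle n (B : (set T)^nat) :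
  (forall i, measurable (B i)) -> measurable (rectangle n B).
Proof.
move=> mB; rewrite (_ : rectangle _ _ = \bigcap_(i in `I_n) [set s | B i (s i)]).
  apply: fin_bigcap_measurable => // i _.
  by apply: sub_sigma_algebra; exists i, (B i).
by apply/seteqP; split.
Qed.

Lemma rectangles_setI : setI_closed rectangles.
Proof.
move=> _ _ [n [B [mB ->]]] [m [C [mC ->]]].
rewrite (rectangle_widen B (leq_maxl n m)) (rectangle_widen C (leq_maxr n m)).
set B' := fun i => _; set C' := fun i => _.
exists (maxn n m), (fun i => B' i `&` C' i); split.
  by move=> i; apply: measurableI; rewrite /B' /C'; case: ifP.
by apply/seteqP; split => [s [sB sC] i im|s sBC];
  [split; [exact: sB|exact: sC]|split=> i /sBC[]].
Qed.

Lemma rectangles_generate : @measurable _ S = <<s rectangles >>.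
Proof.
apply/seteqP; split.
  apply: smallest_sub; first exact: smallest_sigma_algebra.
  move=> _ [i [B [mB ->]]]; apply: sub_sigma_algebra.
  exists i.+1, (fun j => if j == i then B else setT); split.
    by move=> j; case: ifP.
  apply/seteqP; split => s /= sB; last by have := sB i (ltnSn i); rewrite eqxx.
  by move=> j _; case: eqP => // ->.
apply: smallest_sub; first exact: (@sigma_algebra_measurable _ S).
by move=> _ [n [B [mB ->]]]; exact: measurable_rectangle.
Qed.

Definition reindex (h : nat -> nat) (s : S) : S := fun i => s (h i).

Lemma measurable_reindex h : measurable_fun [set: S] (reindex h).
Proof. by apply: measurable_to_seq => i; exact: measurable_coord. Qed.

Lemma measurable_preimage_reindex h (A : set S) :
  measurable A -> measurable (reindex h @^-1` A).
Proof. by move=> mA; rewrite -[X in measurable X]setTI; exact: measurable_reindex. Qed.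

(** Both sides are probabilities in [A], and they agree on rectangles, where a transposition merely
    permutes the factors of a finite product; Dynkin's theorem gives the rest. *)
Lemma infinite_power_transp (R : realType) (mu : probability T R) a b
    (A : set S) : measurable A ->
  infinite_power mu (reindex (transp a b) @^-1` A) = infinite_power mu A.
Proof.
move=> mA; pose t := reindex (transp a b); rewrite -/t.
move: A mA; rewrite {1}rectangles_generate.
apply: (dynkin_induction rectangles_generate rectangles_setI).
- by rewrite preimage_setT.
- move=> _ [n [B [mB ->]]].
  (* The rectangle is padded with full sides until its length [N] exceeds [a] and [b], so that the
     transposition permutes the indices below [N]. *)
  rewrite (rectangle_widen B (leq_maxl n (maxn a b).+1)).
  set N := maxn _ _; pose C i := if (i < n)%N then B i else setT.
  rewrite -/(rectangle N C).
  have mC i : measurable (C i) by rewrite /C; case: ifP.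
  have aN : (a < N)%N by rewrite leq_max ltnS leq_maxl orbT.
  have bN : (b < N)%N by rewrite leq_max ltnS leq_maxr orbT.
  have -> : t @^-1` rectangle N C = rectangle N (C \o transp a b).
    apply/seteqP; split => s sC i iN /=.
      by have := sC _ (transp_lt aN bN iN); rewrite /t /reindex transpK.
    by have := sC _ (transp_lt aN bN iN); rewrite /= transpK.
  rewrite [LHS]infinite_powerE; last by move=> i; exact: mC.
  rewrite [RHS]infinite_powerE//.
  pose h (i : 'I_N) := Ordinal (transp_lt aN bN (ltn_ord i)).
  have h_inj : injective h by move=> i j [] /transp_inj/val_inj.
  by rewrite [RHS](reindex_inj h_inj).
- move=> A mA IH; rewrite preimage_setC !probability_setC ?IH//.
  exact: measurable_preimage_reindex.
- move=> F mF tF IH; rewrite preimage_bigcup !measure_bigcup//.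
  + by apply: eq_eseriesr => k _; exact: IH.
  + by move=> k _; exact: measurable_preimage_reindex.
  + by move=> i j _ _ [s [Fi Fj]]; apply: tF => //; exists (t s).
Qed.

End rectangles.

Section replica_law.
Context d (Omega : measurableType d) (R : realType) (P : probability Omega R).
Context d' (T : measurableType d') (G : {mfun Omega >-> pprobability T R}).
Local Open Scope ereal_scope.
Local Notation S := (seqspace T).

(** On a rectangle the function is a finite product of maps [w |-> G w (B i)]; the sets for which it
    is measurable form a Dynkin system. *)
Lemma measurable_infinite_power (A : set S) : measurable A ->
  measurable_fun setT (fun w => infinite_power (G w) A).
Proof.
rewrite {1}rectangles_generate; move: A.
apply: (@dynkin_induction _ S (@rectangles _ T)
    [set A | measurable_fun setT (fun w => infinite_power (G w) A)]) => /=.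
- exact: rectangles_generate.
- exact: rectangles_setI.
- by under eq_fun do rewrite probability_setT; exact: measurable_cst.
- move=> _ [n [B [mB ->]]] /=.
  under eq_fun do rewrite infinite_powerE//.
  elim: n => [|n IH].
    by under eq_fun do rewrite big_ord0; exact: measurable_cst.
  under eq_fun do rewrite big_ord_recr/=.
  apply: emeasurable_funM => //.
  exact: (measurable_kernel (kprobability (@measurable_funPT _ _ _ _ G))).
- move=> A mA IH /=; under eq_fun do rewrite probability_setC//.
  exact: emeasurable_funB.
- move=> F mF tF IH /=; under eq_fun do rewrite measure_bigcup//.
  by apply: ge0_emeasurable_sum => // k _; exact: IH.
Qed.

(** The annealed law of the replicas. Probabilities [E <I(A)>] become values of a single
    exchangeable probability measure on sequences. *)
Definition replica_law (A : set S) := \int[P]_w infinite_power (G w) A.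

Let replica_law0 : replica_law set0 = 0.
Proof. by apply: integral0_eq => w _; rewrite measure0. Qed.

Let replica_law_ge0 A : 0 <= replica_law A.
Proof. exact: integral_ge0. Qed.

Let replica_law_sigma_additive : semi_sigma_additive replica_law.
Proof.
move=> F mF tF mUF; rewrite [X in _ --> X](_ : _ =
    \int[P]_w \sum_(n <oo) infinite_power (G w) (F n)); last first.
  apply: eq_integral => w _.
  by apply/esym/cvg_lim => //; exact: measure_semi_sigma_additive.
apply/cvg_closeP; split.
  by apply: is_cvg_nneseries => n _ _; exact: integral_ge0.
rewrite closeE// integral_nneseries// => n.
exact: measurable_infinite_power.
Qed.

HB.instance Definition _ := isMeasure.Build _ _ _ replica_law
  replica_law0 replica_law_ge0 replica_law_sigma_additive.

Let replica_lawT : replica_law setT = 1.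
Proof.
rewrite /replica_law (eq_integral (cst 1)).
  by rewrite integral_cst// mul1e; exact: probability_setT.
by move=> w _; rewrite probability_setT.
Qed.

HB.instance Definition _ := Measure_isProbability.Build _ _ _
  replica_law replica_lawT.

Lemma replica_law_transp a b (A : set S) : measurable A ->
  replica_law (reindex (transp a b) @^-1` A) = replica_law A.
Proof.
by move=> mA; apply: eq_integral => w _; rewrite infinite_power_transp.
Qed.

End replica_law.

Lemma replica_avg_indic d (Omega : measurableType d) (R : realType)
    (P : probability Omega R) (H : completeNormedModType R)
    (G : {mfun Omega >-> pprobability (borel H) R})
    (A : set (seqspace (borel H))) : measurable A ->
  replica_avg P G (\1_A : (nat -> H) -> R) = fine (replica_law P G A).
Proof.
move=> mA; rewrite /replica_avg /Rintegral /replica_law; congr fine.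
apply: eq_integral => w _.
by rewrite integral_indic// setIT fineK// fin_num_measure.
Qed.

(** * Measurability of the overlaps *)

Section overlap_theory.
Context (R : realType) (H : completeNormedModType R) (dot : {dot H for idfun}).

Lemma dotC x y : dot x y = dot y x.
Proof. by rewrite (@hermC _ _ idfun _ dot) expr0 mul1r. Qed.

Lemma dotDl x y z : dot (x + y) z = dot x z + dot y z.
Proof. by rewrite sesquilinear.linearDl. Qed.

Lemma dotDr x y z : dot z (x + y) = dot z x + dot z y.
Proof. by rewrite sesquilinear.linearDr. Qed.

Lemma dotBl x y z : dot (x - y) z = dot x z - dot y z.
Proof. by rewrite sesquilinear.linearBl. Qed.

Lemma dotBr x y z : dot z (x - y) = dot z x - dot z y.
Proof. by rewrite sesquilinear.linearBr. Qed.

Lemma dot_suml I (r : seq I) (F : I -> H) y :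
  dot (\sum_(i <- r) F i) y = \sum_(i <- r) dot (F i) y.
Proof. by rewrite sesquilinear.linear_sumlz. Qed.

Lemma dot_sumr I (r : seq I) (F : I -> H) y :
  dot y (\sum_(i <- r) F i) = \sum_(i <- r) dot y (F i).
Proof. by rewrite sesquilinear.linear_sumr. Qed.

Context (norm_dot : forall x : H, `|x| ^+ 2 = dot x x).

(** Polarization: both Cauchy-Schwarz and the measurability of overlaps are thereby reduced to facts
    about norms of sums. *)
Lemma dot_normD x y : dot x y = (`|x + y| ^+ 2 - `|x| ^+ 2 - `|y| ^+ 2) / 2.
Proof. by rewrite !norm_dot dotDl !dotDr (dotC y x); field. Qed.

Lemma dot_cauchy_schwarz x y : dot x y <= `|x| * `|y|.
Proof.
rewrite dot_normD ler_pdivrMr// !lerBlDr.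
have : `|x + y| ^+ 2 <= (`|x| + `|y|) ^+ 2.
  by rewrite lerXn2r ?nnegrE ?addr_ge0// ler_normD.
by rewrite sqrrD => /le_trans; apply; rewrite -!addrA; lra.
Qed.

Lemma overlapC (s : nat -> H) i j : overlap dot s i j = overlap dot s j i.
Proof. exact: dotC. Qed.

Context (sepH : separable H).
Local Notation S := (seqspace (borel H)).

(** The sigma-algebra on sequences only sees one coordinate at a time. Separability decouples the
    sum: [|s_i + s_j| < r] holds iff some [x] of a countable dense set is [1/(k+1)]-close to [s_i]
    with [|s_j + x| < r - 1/(k+1)], which is a countable union of conditions on single
    coordinates. *)
Lemma measurable_coord_normD i j :
  measurable_fun [set: S] (fun s : S => `|(s i : H) + (s j : H)| : R).
Proof.
have [D cD dD] := sepH.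
have lt_aux1 (a b c q : R) : a < c -> c *+ 2 < q - b -> b + a < q - c by lra.
have lt_aux2 (a b c q : R) : a < c -> b < q - c -> a + b < q by lra.
have normlt k (x : H) r : measurable [set s : S | `|(s k : H) - x| < r].
  rewrite (_ : mkset _ = [set s : S | (ball x r) (s k)]).
    rewrite -[X in measurable X]setTI; apply: (measurable_coord k) => //.
    by apply: sub_sigma_algebra; exact: ball_open.
  by apply/seteqP; split => s; rewrite /= -ball_normE /= distrC.
apply: (measurability _ (RGenInftyO.measurableE R)) => _ [_ [r ->] <-].
rewrite setTI (_ : _ @^-1` _ = \bigcup_(k : nat) \bigcup_(x in D)
    ([set s : S | `|(s i : H) - x| < k.+1%:R^-1] `&`
     [set s : S | `|(s j : H) - - x| < r - k.+1%:R^-1])); last first.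
  apply/seteqP; split => s /=; rewrite in_itv/=.
    rewrite -subr_gt0 => lt_r.
    (* One [1/(k+1)] pays for replacing [s_i] by [x], the other for the margin required of
       [|s_j + x|]. *)
    have [k kr] : exists k : nat, k.+1%:R^-1 *+ 2 < r - `|(s i : H) + (s j : H)|.
      have [k] := @ltr_add_invr R 0 ((r - `|(s i : H) + (s j : H)|) / 2) (divr_gt0 lt_r (ltr0Sn _ _)).
      by rewrite add0r ltr_pdivlMr// mulr_natr => ?; exists k.
    have kinv : 0 < k.+1%:R^-1 :> R by rewrite invr_gt0.
    have [x [/= xball Dx]] := dD (ball (s i : H) k.+1%:R^-1)
      (ex_intro _ _ (ballxx _ kinv)) (ball_open _ _).
    rewrite -ball_normE /= in xball.
    exists k => //; exists x => //; split => //=.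
    rewrite opprK (_ : (s j : H) + x = ((s i : H) + (s j : H)) - ((s i : H) - x)).
      by apply: le_lt_trans (ler_normB _ _) _; exact: lt_aux1 xball kr.
    by rewrite opprB (addrC (s i : H)) -addrA subrKC.
  move=> [k _ [x _ [/= six sjx]]].
  rewrite (_ : (s i : H) + (s j : H) = ((s i : H) - x) + ((s j : H) - - x)).
    by apply: le_lt_trans (ler_normD _ _) _; exact: lt_aux2 six sjx.
  by rewrite opprK addrACA addNr addr0.
apply: bigcupT_measurable => k; rewrite bigcup_set_type.
apply: countable_bigcupT_measurable => [|x].
  by rewrite (eq_countable (card_setT _)).
by apply: measurableI; exact: normlt.
Qed.

Lemma measurable_overlap i j :
  measurable_fun [set: S] (fun s : S => overlap dot s i j).
Proof.
rewrite (_ : (fun s : S => _) = (fun s : S => (`|(s i : H) + (s j : H)| ^+ 2 -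
    `|(s i : H)| ^+ 2 - `|(s j : H)| ^+ 2) * 2^-1)); last first.
  by apply/funext => s; exact: dot_normD.
(* The norm of a coordinate is half the norm of its sum with itself. *)
have mN k : measurable_fun [set: S] (fun s : S => `|(s k : H)| : R).
  rewrite (_ : (fun s : S => _) =
      (fun s : S => `|(s k : H) + (s k : H)| * 2^-1)).
    by apply: measurable_funM => //; exact: measurable_coord_normD.
  by apply/funext => s; rewrite -mulr2n normrMn -[X in X / _]mulr_natr mulfK.
apply: measurable_funM => //; apply: measurable_funB.
  by apply: measurable_funB; apply: measurable_funX => //; exact: measurable_coord_normD.
exact: measurable_funX.
Qed.

Lemma measurable_overlap_in (i j : nat) (B : set R) : measurable B ->
  measurable [set s : S | B (overlap dot s i j)].
Proof.
by move=> mB; rewrite -[X in measurable X]setTI; exact: measurable_overlap.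
Qed.

Lemma measurable_overlaps n : measurable_fun [set: S] (@overlaps R H dot n).
Proof.
apply/measurable_fun_tnthP => i; apply/measurable_fun_tnthP => j.
rewrite (_ : _ \o _ = (fun s : S => overlap dot s i j)).
  exact: measurable_overlap.
by apply/funext => s /=; rewrite !tnth_mktuple.
Qed.

End overlap_theory.

(** * The Ghirlanda-Guerra identities for events *)

Section ghirlanda_guerra_events.
Context d (Omega : measurableType d) (R : realType) (P : probability Omega R).
Context (H : completeNormedModType R) (dot : {dot H for idfun}).
Context (norm_dot : forall x : H, `|x| ^+ 2 = dot x x) (sepH : separable H).
Context (G : {mfun Omega >-> pprobability (borel H) R}).
Context (GG : ghirlanda_guerra P dot G).
Local Notation S := (seqspace (borel H)).
Local Notation Q := (replica_law P G).

Lemma bounded_indic T (A : set T) : bounded_fun (\1_A : T -> R).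
Proof.
exists 1; split; first exact: num_real.
move=> x x1 y _ /=; rewrite indicE normr_nat (le_trans _ (ltW x1))//.
by rewrite lern1 leq_b1.
Qed.

Lemma replica_avg_indicM T T' (f : S -> T) (g : S -> T') A B :
  measurable (f @^-1` A) -> measurable (g @^-1` B) ->
  replica_avg P G (fun s => \1_A (f s) * \1_B (g s)) =
    fine (Q (f @^-1` A `&` g @^-1` B)).
Proof.
move=> mA mB; rewrite -replica_avg_indic; last exact: measurableI.
by congr replica_avg; apply/funext => s; rewrite indicI.
Qed.

(** The identities for indicator functions, multiplied by [n] to clear the inverses. *)
Lemma ghirlanda_guerra_event n (A : set (n.-tuple (n.-tuple R))) (B : set R) :
  (2 <= n)%N -> measurable A -> measurable B ->
  let E : set S := overlaps dot n @^-1` A in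
  let D l : set S := [set s | B (overlap dot s 0 l)] in
  n%:R * fine (Q (E `&` D n)) =
    fine (Q E) * fine (Q (D 1)) + \sum_(1 <= l < n) fine (Q (E `&` D l)).
Proof.
move=> n2 mA mB E D.
have mE : measurable E.
  by rewrite -[X in measurable X]setTI; exact: measurable_overlaps.
have mD l : measurable (D l) by exact: measurable_overlap_in.
have := GG n2 (measurable_indic mA) (bounded_indic A) (measurable_indic mB) (bounded_indic B).
have avgM l : replica_avg P G (fun s => \1_A (overlaps dot n s) * \1_B (overlap dot s 0 l)) =
    fine (Q (E `&` D l)) by exact: (replica_avg_indicM (f := overlaps dot n) (g := fun s => overlap dot s 0 l) mE (mD l)).
have avgA : replica_avg P G (fun s => \1_A (overlaps dot n s)) = fine (Q E).
  by rewrite -replica_avg_indic.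
have avgB : replica_avg P G (fun s => \1_B (overlap dot s 0 1)) = fine (Q (D 1)).
  by rewrite -replica_avg_indic.
rewrite avgM avgA avgB.
under eq_bigr do rewrite avgM.
have n0 : n%:R != 0 :> R by rewrite pnatr_eq0 -lt0n ltnW.
by move=> ->; rewrite mulrDr -mulrA !mulVKf.
Qed.

End ghirlanda_guerra_events.

(** * Duplication *)

Lemma harmonic_series_unbounded (R : realType) (M : R) :
  exists N, M < \sum_(k < N) k.+1%:R^-1.
Proof.
apply: contrapT => /forallNP bounded; apply: (@dvg_harmonic R).
apply: nondecreasing_is_cvgn.
  apply: nondecreasing_series => k _ _; exact: harmonic_ge0.
exists M => _ [N _ <-]; have /negP := bounded N.
by rewrite -leNgt seriesEord.
Qed.

Section probability_values.
Context d (T : measurableType d) (R : realType) (Q : probability T R).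
Local Open Scope ereal_scope.

Lemma fine_probabilityK A : measurable A -> (fine (Q A))%:E = Q A.
Proof. by move=> mA; rewrite fineK// fin_num_measure. Qed.

Lemma le_fine_probability A B : measurable A -> measurable B -> A `<=` B ->
  (fine (Q A) <= fine (Q B))%R.
Proof.
move=> mA mB AB; rewrite -lee_fin !fine_probabilityK//.
by apply: le_measure => //; rewrite inE.
Qed.

Lemma fine_probability_gt0 A : measurable A -> (0 < fine (Q A))%R = (0 < Q A).
Proof. by move=> mA; rewrite -lte_fin fine_probabilityK. Qed.

Lemma sum_fine_probability_le1 (F : (set T)^nat) N :
  (forall k, measurable (F k)) -> trivIset setT F ->
  (\sum_(k < N) fine (Q (F k)) <= 1)%R.
Proof.
move=> mF tF; rewrite -lee_fin -sumEFin.
under eq_bigr do rewrite fine_probabilityK//.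
rewrite -(@measure_bigsetU _ _ _ Q F)//.
by apply: probability_le1; exact: bigsetU_measurable.
Qed.

End probability_values.

Section duplication.
Context d (Omega : measurableType d) (R : realType) (P : probability Omega R).
Context (H : completeNormedModType R) (dot : {dot H for idfun}).
Context (norm_dot : forall x : H, `|x| ^+ 2 = dot x x) (sepH : separable H).
Context (G : {mfun Omega >-> pprobability (borel H) R}).
Context (GG : ghirlanda_guerra P dot G).
Local Notation S := (seqspace (borel H)).
Local Notation Q := (replica_law P G).

(** These are the events whose indicators can play the role of [f] in the identities for [n]
    replicas. *)
Definition overlap_event n : set (set S) := [set A |
  exists2 A' : set (n.-tuple (n.-tuple R)), measurable A' &
    A = overlaps dot n @^-1` A'].

Lemma overlap_event_measurable n A : overlap_event n A -> measurable A.
Proof.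
move=> [A' mA' ->].
by rewrite -[X in measurable X]setTI; exact: measurable_overlaps.
Qed.

Lemma overlap_event_determined n A : overlap_event n A -> determined n A.
Proof.
move=> [A' _ ->] s t st; rewrite /preimage/=.
congr (A' _); apply: eq_from_tnth => i; apply: eq_from_tnth => j.
by rewrite !tnth_mktuple /overlap !st.
Qed.

(** Renumbering replicas only selects entries of the overlap array, which is a measurable operation
    on arrays. *)
Lemma overlap_event_reindex h m n A : (forall i, (i < m)%N -> (h i < n)%N) ->
  overlap_event m A -> overlap_event n (reindex h @^-1` A).
Proof.
move=> hmn [A' mA' ->].
pose h' (i : 'I_m) := Ordinal (hmn i (ltn_ord i)).
pose f (M : n.-tuple (n.-tuple R)) : m.-tuple (m.-tuple R) :=
  [tuple [tuple tnth (tnth M (h' i)) (h' j) | j < m] | i < m].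
have mf : measurable_fun setT f.
  apply/measurable_fun_tnthP => i; apply/measurable_fun_tnthP => j.
  rewrite (_ : _ \o _ = (@tnth n R)^~ (h' j) \o (@tnth n _)^~ (h' i)).
    by apply: measurableT_comp; exact: measurable_tnth.
  by apply/funext => M /=; rewrite !tnth_mktuple.
exists (f @^-1` A'); first by rewrite -[X in measurable X]setTI; exact: mf.
rewrite -comp_preimage; apply/seteqP.
suff E (s : S) : overlaps dot m (reindex h s) = f (overlaps dot n s).
  by split=> s /=; rewrite /preimage/= E.
by apply: eq_from_tnth => i; apply: eq_from_tnth => j; rewrite !tnth_mktuple.
Qed.

Lemma overlap_event_widen m n A : (m <= n)%N ->
  overlap_event m A -> overlap_event n A.
Proof.
by move=> mn /(@overlap_event_reindex id m n); apply=> i /leq_trans; exact.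
Qed.

Lemma overlap_eventT n : overlap_event n setT.
Proof. by exists setT. Qed.

Lemma overlap_eventI n A B :
  overlap_event n A -> overlap_event n B -> overlap_event n (A `&` B).
Proof.
by move=> [A' mA ->] [B' mB ->]; exists (A' `&` B') => //; exact: measurableI.
Qed.

Lemma overlap_event_pair n i j (B : set R) : (i < n)%N -> (j < n)%N ->
  measurable B -> overlap_event n [set s | B (overlap dot s i j)].
Proof.
move=> i_n j_n mB.
exists (((@tnth n R)^~ (Ordinal j_n) \o (@tnth n _)^~ (Ordinal i_n)) @^-1` B).
  rewrite -[X in measurable X]setTI.
  by apply: measurableT_comp => //; exact: measurable_tnth.
by apply/seteqP; split => s; rewrite /preimage/= !tnth_mktuple.
Qed.

Lemma overlap_event_forall n k (F : (set S)^nat) :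
  (forall i, (i < k)%N -> overlap_event n (F i)) ->
  overlap_event n [set s | forall i, (i < k)%N -> F i s].
Proof.
elim: k => [|k IH] oF.
  by rewrite (_ : mkset _ = setT); [exact: overlap_eventT|apply/seteqP].
rewrite (_ : mkset _ = [set s | forall i, (i < k)%N -> F i s] `&` F k).
  by apply: overlap_eventI; [apply: IH => i ik; apply: oF; exact: ltnW|exact: oF].
apply/seteqP; split => s /=.
  by move=> sF; split=> [i ik|]; apply: sF; rewrite // ltnS ltnW.
by move=> [sF Fk] i; rewrite ltnS leq_eqVlt => /predU1P[->//|/sF].
Qed.

(** The lower bound on [b_k] by induction on [k]. Here [A] involves [n.+1] replicas, so [n] counts
    the replicas other than the first. *)
Lemma overlap_event_decay n A theta k :
  (0 < n)%N -> overlap_event n.+1 A ->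
  (forall s, A s -> forall l, (0 < l <= n)%N -> overlap dot s 0 l < theta) ->
  n%:R * fine (Q A) <= (n + k)%:R * fine (Q (A `&`
    [set s | forall j, (j < k)%N -> overlap dot s 0 (n.+1 + j) < theta])).
Proof.
move=> n0 oA A_lt.
pose E k' := A `&` [set s : S |
  forall j, (j < k')%N -> overlap dot s 0 (n.+1 + j) < theta].
rewrite -/(E k).
have mlt : measurable [set x : R | x < theta].
  by rewrite -set_itvNyo; exact: measurable_itv.
have oE k' : overlap_event (n.+1 + k') (E k').
  apply: overlap_eventI; first exact: overlap_event_widen (leq_addr _ _) oA.
  apply: overlap_event_forall => j jk.
  by apply: (overlap_event_pair _ _ mlt); lia.
have mE k' := overlap_event_measurable (oE k').
elim: k => [|k IH].
  by rewrite addn0 (_ : E 0 = A)//; apply/seteqP; split=> [s []|s As]//; split.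
apply: le_trans IH _.
have [A' mA' EA'] := oE k.
have n2 : (2 <= n.+1 + k)%N by lia.
have /= := ghirlanda_guerra_event norm_dot sepH GG n2 mA' mlt.
rewrite -EA' (_ : E k `&` _ = E k.+1); last first.
  apply/seteqP; split => [s [[As sk] lt]|s [As sk]].
    by split=> // j; rewrite ltnS leq_eqVlt => /predU1P[->|/sk].
  by split; [split=> // j jk; apply: sk; exact: ltnW|exact: sk].
(* On [E k] each of the other [n + k] replicas already has overlap [< theta] with replica 0, so
   every term of the sum equals the probability of [E k]. *)
rewrite (eq_big_nat _ _ (F2 := fun=> fine (Q (E k)))); last first.
  move=> l l_n; congr (fine (Q _)); apply/seteqP; split => [s []//|s [As sk]].
  split=> //=; have [ln|nl] := leqP l n; first by apply: A_lt => //; lia.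
  by have := sk (l - n.+1)%N; rewrite subnKC//; apply; lia.
rewrite sumr_const_nat; set b := fine (Q (E k)); set b' := fine (Q (E k.+1)).
set c := fine _ => eb'.
(* The product term [b * c] of the identity is nonnegative and is dropped, leaving
   [(n + k) b <= (n + k + 1) b']. *)
have c0 : 0 <= b * c by rewrite mulr_ge0// fine_ge0.
by rewrite addnS -addSn eb' mulr_natl addSn subn1/= lerDr.
Qed.

(** The preimage of [A] under the transposition is the event that the new replica [n.+1] can take
    the place of replica 0 in [A], replicas 1 to [n] being kept. *)
Lemma overlap_event_duplicate n A theta :
  (0 < n)%N -> overlap_event n.+1 A ->
  (forall s, A s -> forall l, (0 < l <= n)%N -> overlap dot s 0 l < theta) ->
  (0 < Q A)%E ->
  (0 < Q (A `&` reindex (transp 0 n.+1) @^-1` A `&`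
          [set s | (overlap dot s 0 n.+1 < theta)%R]))%E.
Proof.
move=> n0 oA A_lt QA; set dup := (X in (0 < Q X)%E).
rewrite lt0e measure_ge0 andbT; apply/eqP => Qdup.
have mA := overlap_event_measurable oA.
have dA := overlap_event_determined oA.
pose C j := reindex (transp 0 (n.+1 + j)) @^-1` A.
have mC j : measurable (C j) by exact: measurable_preimage_reindex.
pose V j := [set s : S | overlap dot s 0 (n.+1 + j) < theta].
have mV j : measurable (V j).
  apply: (measurable_overlap_in norm_dot sepH _ _ (B := [set x | x < theta])).
  by rewrite -set_itvNyo; exact: measurable_itv.
(* Exchangeability carries the assumed nullity from the candidate [n.+1] to every candidate
   [n.+1 + j], since [A] ignores replicas beyond [n]. *)
have Qnull j : Q (A `&` C j `&` V j) = 0%E.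
  have mACV i : measurable (A `&` C i `&` V i).
    by apply: measurableI => //; exact: measurableI.
  rewrite -[RHS]Qdup (_ : dup = A `&` C 0%N `&` V 0%N); last first.
    by rewrite /dup /C /V addn0.
  rewrite -(replica_law_transp P G n.+1 (n.+1 + j) (mACV 0%N)).
  congr (Q _); rewrite !preimage_setI; congr (_ `&` _ `&` _).
  - apply/seteqP; split => s; apply: dA => i i_n; rewrite /reindex transpD//; lia.
  - apply/seteqP; split => s; rewrite /C /preimage/=; apply: dA => i i_n.
      rewrite /reindex addn0; have [->|i0] := eqVneq i 0%N.
        by rewrite !transpL.
      rewrite !(transpD (a := 0%N)) ?transpD//; lia.
    rewrite /reindex addn0; have [->|i0] := eqVneq i 0%N.
      by rewrite !transpL.
    rewrite !(transpD (a := 0%N)) ?transpD//; lia.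
  - apply/seteqP; split => s; rewrite /V /preimage/= /overlap /reindex addn0;
      by rewrite transpL transpD.
pose N := \bigcup_j (A `&` C j `&` V j).
pose E k := A `\` \bigcup_(j < k) C j.
(* [F k]: among the replicas numbered from [n.+1] on, the first one that can
   replace replica 0 in [A] is [n.+1 + k]. *)
pose F k := C k `\` \bigcup_(j < k) C j.
have mU k : measurable (\bigcup_(j < k) C j) by exact: bigcup_measurable.
(* [C j] reads only replicas 1 to [n] and [n.+1 + j], hence is invariant under exchanging replicas 0
   and [n.+1 + k]. *)
have CD j k : j != k -> reindex (transp 0 (n.+1 + k)) @^-1` C j = C j.
  move=> jk; suff st (s : S) i : (i < n.+1)%N ->
      reindex (transp 0 (n.+1 + j)) (reindex (transp 0 (n.+1 + k)) s) i =
      reindex (transp 0 (n.+1 + j)) s i.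
    by apply/seteqP; split => s; apply: dA => i /st->.
  rewrite /reindex; have [->|i0] := eqVneq i 0%N.
    by rewrite !transpL transpD ?eqn_add2l.
  by move=> i_n; rewrite !(transpD (a := 0%N))//; lia.
(* The exchange of 0 and [n.+1 + k] turns [A] into [C k] and fixes the earlier [C j]. *)
have EF k : Q (E k) = Q (F k).
  rewrite -(replica_law_transp P G 0 (n.+1 + k)); last exact: measurableD.
  rewrite /E /F; have {2}<- : reindex (transp 0 (n.+1 + k)) @^-1` (\bigcup_(j < k) C j) =
      \bigcup_(j < k) C j => //.
  by rewrite preimage_bigcup; apply: eq_bigcupr => j /= jk; rewrite CD// ltn_eqF.
(* Outside the null event [N], on [A], a replica with overlap [< theta] to replica 0 cannot replace
   it. *)
have leF k : fine (Q (A `&` [set s | forall j, (j < k)%N -> V j s])) <=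
    fine (Q (F k)).
  have mN : measurable N.
    apply: bigcupT_measurable => j; apply: measurableI => //.
    exact: measurableI.
  have QN : Q N = 0%E.
    apply: measure_negligible => //; apply: negligible_bigcup => j.
    exists (A `&` C j `&` V j); split=> //; last exact: Qnull.
    by apply: measurableI => //; exact: measurableI.
  rewrite -EF -(measureU0 (measurableD mA (mU k)) mN QN).
  apply: le_fine_probability.
  - apply: measurableI => //.
    rewrite (_ : mkset _ = \bigcap_(j in `I_k) V j); last by apply/seteqP; split.
    by apply: fin_bigcap_measurable => // j _; exact: mV.
  - by apply: measurableU => //; exact: measurableD.
  - move=> s [As sV]; have [[j jk Cjs]|nC] := pselect ((\bigcup_(j < k) C j) s).
      by right; exists j => //; split=> //; exact: sV.
    by left.
have tF : trivIset setT F.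
  suff tFlt i j : (i < j)%N -> F i `&` F j = set0.
    apply/trivIsetP => i j _ _; rewrite neq_ltn => /orP[|/tFlt]; first exact: tFlt.
    by rewrite setIC.
  by move=> ij; apply/seteqP; split => // s [[Cis _] [_ nC]]; apply: nC; exists i.
have mF k : measurable (F k) by exact: measurableD.
have QA' : 0 < fine (Q A) by rewrite fine_probability_gt0.
(* The decay bound gives [Q A / (k+1) <= (n+1) Q (F k)], by the crude estimate
   [n + k <= n (n+1) (k+1)]. As the [F k] are disjoint, summing bounds the harmonic series by
   [(n+1) / Q A]. *)
have [K] := harmonic_series_unbounded (n.+1%:R / fine (Q A)).
rewrite ltNge => /negP; apply; rewrite ler_pdivlMr// mulr_suml.
apply: (@le_trans _ _ (n.+1%:R * \sum_(k < K) fine (Q (F k)))); last first.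
  by rewrite -[leRHS]mulr1 ler_wpM2l// sum_fine_probability_le1.
rewrite mulr_sumr; apply: ler_sum => k _.
rewrite mulrC ler_pdivrMr//.
rewrite -(ler_pM2l (_ : 0 < n%:R :> R)) ?ltr0n//.
apply: le_trans (overlap_event_decay k n0 oA A_lt) _.
apply: le_trans (ler_wpM2l (ler0n _ _) (leF k)) _.
rewrite [_ * k.+1%:R]mulrC !mulrA -!natrM.
by rewrite ler_wpM2r ?fine_ge0// ler_nat; nia.
Qed.

End duplication.

(** * Growing clusters of replicas by repeated duplication *)

Section colored_configurations.
Context d (Omega : measurableType d) (R : realType) (P : probability Omega R).
Context (H : completeNormedModType R) (dot : {dot H for idfun}).
Context (norm_dot : forall x : H, `|x| ^+ 2 = dot x x) (sepH : separable H).
Context (G : {mfun Omega >-> pprobability (borel H) R}).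
Context (GG : ghirlanda_guerra P dot G).
Local Notation S := (seqspace (borel H)).
Local Notation Q := (replica_law P G).
Context (I : Type) (t : nat -> I) (K : I -> I -> set R) (theta : I -> R).
Context (mK : forall a b, measurable (K a b)).
Context (KC : forall a b x, K a b x -> K b a x).
Context (K_lt : forall a b x, K a b x -> x < theta a).
Context (K_diag : forall a x, x < theta a -> K a a x).

(** [K a b] is the range allowed for overlaps between colors [a] and [b]. By [K_lt] and [K_diag],
    [K a a] is the half-line below [theta a]: within a color only an upper bound is imposed, which
    is all that duplication can deliver. Self-overlaps are left free. *)
Definition colored n : set S := [set s | forall i, (i < n)%N ->
  forall j, (j < n)%N -> i != j -> K (t i) (t j) (overlap dot s i j)].

Lemma colored_event n : overlap_event dot n (colored n).
Proof.
apply: overlap_event_forall => i i_n; apply: overlap_event_forall => j j_n.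
have [->|ij] := eqVneq i j.
  by rewrite [X in overlap_event _ _ X](_ : _ = setT); [exact: overlap_eventT|apply/seteqP].
rewrite [X in overlap_event _ _ X](_ : _ = [set s | K (t i) (t j) (overlap dot s i j)]).
  exact: overlap_event_pair.
by apply/seteqP; split => s //=; apply.
Qed.

Lemma measurable_colored n : measurable (colored n).
Proof. exact: overlap_event_measurable (colored_event n). Qed.

(** Replica [p] is moved to position 0 and duplicated with threshold [theta (t p)], which bounds all
    its overlaps by [K_lt]. The duplicate inherits the constraints of [p] with the other replicas,
    and its overlap with [p] is admissible by [K_diag]. *)
Lemma colored_extend n p : (1 < n)%N -> (p < n)%N -> t n = t p ->
  (0 < Q (colored n))%E -> (0 < Q (colored n.+1))%E.
Proof.
case: n => // n n0 pn tn Qn.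
pose A : set S := reindex (transp 0 p) @^-1` colored n.+1.
have tr_lt i : (i < n.+1)%N -> (transp 0 p i < n.+1)%N by exact: transp_lt.
have oA : overlap_event dot n.+1 A.
  exact: overlap_event_reindex tr_lt (colored_event n.+1).
have QA : (0 < Q A)%E by rewrite replica_law_transp//; exact: measurable_colored.
have A_lt s : A s -> forall l, (0 < l <= n)%N -> overlap dot s 0 l < theta (t p).
  move=> As l /andP[l0 ln]; apply: (K_lt (b := t (transp 0 p l))).
  have := As p pn (transp 0 p l) (tr_lt _ ln).
  rewrite /overlap /reindex transpR transpK; apply.
  by rewrite -(inj_eq (@transp_inj 0 p)) transpK transpR eq_sym -lt0n.
have := overlap_event_duplicate norm_dot sepH GG n0 oA A_lt QA.
move=> /lt_le_trans; apply.
rewrite -(replica_law_transp P G 0 p (measurable_colored n.+2)).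
apply: le_measure; rewrite ?inE.
- apply: measurableI; first apply: measurableI.
  + exact: overlap_event_measurable oA.
  + by apply: measurable_preimage_reindex; exact: overlap_event_measurable oA.
  + apply: (measurable_overlap_in norm_dot sepH _ _ (B := [set x | x < theta (t p)])).
    by rewrite -set_itvNyo; exact: measurable_itv.
- by apply: measurable_preimage_reindex; exact: measurable_colored.
move=> s [[As A's] lt_s].
(* Constraints on the new replica: against [p] they come from the threshold, against any other
   replica from the second copy of [A]. *)
have last i : (i < n.+1)%N ->
    K (t i) (t n.+1) (overlap dot (reindex (transp 0 p) s) i n.+1).
  move=> i_n; rewrite /overlap /reindex (@transpD _ _ n.+1)//; last by lia.
  rewrite tn; have [->|ip] := eqVneq i p.
    by rewrite transpR; exact: K_diag.
  have := A's i i_n p pn ip; rewrite /overlap /reindex transpR transpL.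
  rewrite (@transpD 0 n.+1)//; last by rewrite ltn_eqF// tr_lt.
  by rewrite -(inj_eq (@transp_inj 0 p)) transpK transpL.
move=> i; rewrite ltnS leq_eqVlt => /predU1P[->|i_n] j; rewrite ltnS leq_eqVlt.
  move=> /predU1P[->|j_n _]; first by rewrite eqxx.
  by apply: KC; rewrite (overlapC dot); exact: last.
by move=> /predU1P[-> _|j_n ij]; [exact: last|exact: As].
Qed.

End colored_configurations.

(** * Barycenters of clusters *)

Section barycenters.
Context (R : realType) (H : completeNormedModType R) (dot : {dot H for idfun}).
Context (norm_dot : forall x : H, `|x| ^+ 2 = dot x x).

Lemma dot_sum2 m (u v : 'I_m -> H) :
  dot (\sum_k u k) (\sum_k v k) = \sum_k \sum_l dot (u k) (v l).
Proof.
by rewrite dot_suml; apply: eq_bigr => k _; rewrite dot_sumr.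
Qed.

Lemma dot_sum2_le m (u v : 'I_m -> H) a : (forall k l, dot (u k) (v l) <= a) ->
  dot (\sum_k u k) (\sum_k v k) <= m%:R ^+ 2 * a.
Proof.
move=> uv; rewrite dot_sum2.
have -> : m%:R ^+ 2 * a = \sum_(k < m) \sum_(l < m) a.
  by rewrite !sumr_const !card_ord -!mulrnA expr2 -natrM mulr_natl.
by apply: ler_sum => k _; apply: ler_sum => l _.
Qed.

Lemma dot_sum2_ge m (u v : 'I_m -> H) a : (forall k l, a <= dot (u k) (v l)) ->
  m%:R ^+ 2 * a <= dot (\sum_k u k) (\sum_k v k).
Proof.
move=> uv; rewrite dot_sum2.
have -> : m%:R ^+ 2 * a = \sum_(k < m) \sum_(l < m) a.
  by rewrite !sumr_const !card_ord -!mulrnA expr2 -natrM mulr_natl.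
by apply: ler_sum => k _; apply: ler_sum => l _.
Qed.

(** Diagonal terms are bounded by 1 only; there are [m] of them among [m^2], whence the error
    [O(1/m)] for barycenters. *)
Lemma dot_sum_diag_le m (u : 'I_m -> H) a : (forall k, `|u k| <= 1) ->
  (forall k l, k != l -> dot (u k) (u l) <= a) ->
  dot (\sum_k u k) (\sum_k u k) <= m%:R * (1 + (m%:R - 1) * a).
Proof.
move=> u1 ua; rewrite dot_sum2.
have -> : m%:R * (1 + (m%:R - 1) * a) = \sum_(k < m) (1 + (m%:R - 1) * a).
  by rewrite sumr_const card_ord mulr_natl.
apply: ler_sum => k _; rewrite (bigD1 k)//= lerD//.
  by rewrite -norm_dot expr_le1.
have -> : (m%:R - 1) * a = \sum_(l < m | l != k) a.
  rewrite sumr_const cardC1 card_ord -[RHS]mulr_natl.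
  by case: m u u1 ua k => [u u1 ua []//|m u u1 ua k]; rewrite -natr1 addrK.
by apply: ler_sum => l lk; apply: ua; rewrite eq_sym.
Qed.

(** The sums [U], [V], [W] are [m] times the barycenters. Cauchy-Schwarz gives
    [m^2 (b - a) <= U.(W - V) <= m |W - V|], while expanding the square gives [|W - V|^2 <= 2 m (1 +
    (m - 1)(c + e)) - 2 m^2 c <= m (4 + 2 e m)]. *)
Lemma clusters_gap m (u v w : 'I_m -> H) a b c e : (0 < m)%N -> a <= b ->
  (forall k, `|u k| <= 1) -> (forall k, `|v k| <= 1) -> (forall k, `|w k| <= 1) ->
  (forall k l, dot (u k) (v l) <= a) -> (forall k l, b <= dot (u k) (w l)) ->
  (forall k l, c <= dot (v k) (w l) <= c + e) ->
  (forall k l, k != l -> dot (v k) (v l) <= c + e) ->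
  (forall k l, k != l -> dot (w k) (w l) <= c + e) ->
  m%:R * (b - a) ^+ 2 <= 4 + 2 * e * m%:R.
Proof.
move=> m0 ab u1 v1 w1 uv uw vw vv ww.
set U := \sum_k u k; set V := \sum_k v k; set W := \sum_k w k.
have UV : dot U V <= m%:R ^+ 2 * a by exact: dot_sum2_le.
have UW : m%:R ^+ 2 * b <= dot U W by exact: dot_sum2_ge.
have VW : m%:R ^+ 2 * c <= dot V W.
  by apply: dot_sum2_ge => k l; have /andP[] := vw k l.
have VV := dot_sum_diag_le v1 vv; have WW := dot_sum_diag_le w1 ww.
rewrite -/V in VV; rewrite -/W in WW.
have UM : `|U| <= m%:R.
  apply: le_trans (ler_norm_sum _ _ _) _.
  have -> : m%:R = \sum_(k < m) 1 :> R by rewrite sumr_const card_ord.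
  by apply: ler_sum.
have CS := dot_cauchy_schwarz norm_dot U (W - V).
have N2 := norm_dot (W - V).
rewrite dotBl !dotBr in CS N2; rewrite (dotC _ W V) in N2.
pose o := Ordinal m0.
(* This controls the remaining term [- 2 m (c + e)] in the expansion of [|W - V|^2]. *)
have ce : -1 <= c + e.
  have /andP[_] := vw o o; apply: le_trans.
  have := dot_normD norm_dot (v o) (w o) => ->.
  have := v1 o; have := w1 o; have := normr_ge0 (v o); have := normr_ge0 (w o).
  have := sqr_ge0 `|v o + w o|; nra.
have M0 : 0 < m%:R :> R by rewrite ltr0n.
(* Only real arithmetic remains: [p = |U|], [q = |W - V|], [M = m], and the scalar products become
   variables. *)
move: CS N2 UV UW VW VV WW UM ce (normr_ge0 (W - V)) (normr_ge0 U).
move: M0; move: `|U| `|W - V| => p q.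
move: (dot U V) (dot U W) (dot V W) (dot V V) (dot W W) (m%:R : R).
move=> uv' uw' vw' vv' ww' M M0 CS N2 UV UW VW VV WW UM ce q0 p0.
have q1 : M * (b - a) <= q.
  rewrite -(ler_pM2l M0); apply: (@le_trans _ _ (p * q)); first by lra.
  exact: ler_wpM2r.
have q2 : q ^+ 2 <= M * (4 + 2 * e * M) by nra.
rewrite -(ler_pM2l M0); apply: le_trans q2.
rewrite mulrA -expr2 -exprMn ler_pXn2r// ?nnegrE//.
by rewrite mulr_ge0 ?subr_ge0// ltW.
Qed.

End barycenters.

(** * Ultrametricity *)

Variant color := Color0 | Color1 | Color2.

(** Clusters are interleaved modulo 3: the first three replicas form the initial configuration, and
    each later replica [n] duplicates [n - 3]. The [k]-th member of cluster [i] is replica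
    [3 * k + i]. *)
Definition color_of (i : nat) : color :=
  match (i %% 3)%N with 0 => Color0 | 1 => Color1 | _ => Color2 end.

Lemma color_ofMD k i : color_of (3 * k + i) = color_of i.
Proof. by rewrite /color_of mulnC modnMDl. Qed.

Section ultrametricity.
Context d (Omega : measurableType d) (R : realType) (P : probability Omega R).
Context (H : completeNormedModType R) (dot : {dot H for idfun}).
Context (norm_dot : forall x : H, `|x| ^+ 2 = dot x x) (sepH : separable H).
Context (G : {mfun Omega >-> pprobability (borel H) R}).
Context (G_ball : forall w,
  (G w : probability (borel H) R) [set x | `|x| <= 1] = 1%E).
Context (GG : ghirlanda_guerra P dot G).
Local Notation S := (seqspace (borel H)).
Local Notation Q := (replica_law P G).

Lemma measurable_unit_ball : measurable ([set x | `|x| <= 1] : set (borel H)).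
Proof.
rewrite (_ : mkset _ = ~` [set x : H | 1 < `|x|]).
  apply: measurableC; apply: sub_sigma_algebra.
  apply: (@open_comp _ _ (fun x : H => `|x|) [set r : R | 1 < r]).
    by move=> x _; exact: norm_continuous.
  exact: open_gt.
by apply/seteqP; split => x /=; rewrite leNgt => /negP.
Qed.

Lemma replica_law_balls n :
  Q (rectangle n (fun=> [set x : borel H | `|x : H| <= 1])) = 1%E.
Proof.
rewrite /replica_law (eq_integral (cst 1%E)); last first.
  move=> w _; rewrite infinite_powerE; last by move=> _; exact: measurable_unit_ball.
  by rewrite big1// => i _; exact: G_ball.
by rewrite integral_cst// mul1e; exact: probability_setT.
Qed.

(** Extracts from an event of positive probability an actual configuration in the unit ball, to
    which the deterministic estimate on clusters applies. *)
Lemma replica_law_gt0_balls n A : measurable A -> (0 < Q A)%E ->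
  exists2 s : S, A s & forall i, (i < n)%N -> `|(s i : H)| <= 1.
Proof.
move=> mA QA; apply: contrapT => AB.
set B := rectangle n (fun=> [set x : borel H | `|x : H| <= 1]).
have mB : measurable B.
  by apply: measurable_rectangle => _; exact: measurable_unit_ball.
move: QA; rewrite lt0e => /andP[/negP QA _]; apply: QA; apply/eqP/le_anti.
rewrite measure_ge0 andbT; apply: (@le_trans _ _ (Q (~` B))).
  apply: le_measure; rewrite ?inE//; first exact: measurableC.
  by move=> s As Bs; apply: AB; exists s.
by rewrite probability_setC// [X in (_ - X)%E]replica_law_balls subee.
Qed.

Definition cell (a b c e : R) : set S :=
  [set s : S | [/\ overlap dot s 0 1 < a, b <= overlap dot s 0 2 < b + e &
                   c <= overlap dot s 1 2 < c + e]].

Lemma measurable_cell a b c e : measurable (cell a b c e).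
Proof.
rewrite (_ : cell a b c e = [set s | `]-oo, a[%classic (overlap dot s 0 1)] `&`
    [set s | `[b, b + e[%classic (overlap dot s 0 2)] `&`
    [set s | `[c, c + e[%classic (overlap dot s 1 2)]).
  by apply: measurableI; first apply: measurableI;
    apply: measurable_overlap_in => //; exact: measurable_itv.
by apply/seteqP; split => s /=; rewrite !in_itv/=; [case|case=> -[]].
Qed.

Lemma cell_null (a b c e : R) : a <= b -> b <= c -> 0 < e -> 2 * e < (b - a) ^+ 2 ->
  Q (cell a b c e) = 0%E.
Proof.
move=> ab bc e0 e_small.
pose K i j : set R := match i, j with
  | Color0, Color0 => `]-oo, b + e[%classic
  | Color1, Color1 | Color2, Color2 => `]-oo, c + e[%classic
  | Color0, Color1 | Color1, Color0 => `]-oo, a[%classic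
  | Color0, Color2 | Color2, Color0 => `[b, b + e[%classic
  | Color1, Color2 | Color2, Color1 => `[c, c + e[%classic
  end.
(* Each threshold is the largest upper end of the windows involving that color; this uses
   [a <= b <= c] and [0 < e]. *)
pose theta i := match i with Color0 => b + e | _ => c + e end.
have mK i j : measurable (K i j) by case: i; case: j; exact: measurable_itv.
have KC i j x : K i j x -> K j i x by case: i; case: j.
have K_diag i x : x < theta i -> K i i x by case: i => /=; rewrite in_itv.
have K_lt i j x : K i j x -> x < theta i.
  by case: i; case: j => /=; rewrite in_itv/=; lra.
pose col n := colored dot color_of K n.
have mcol n : measurable (col n) by exact: measurable_colored.
have subcol : cell a b c e `<=` col 3%N.
  move=> s [s01 s02 s12] [|[|[|//]]] _ [|[|[|//]]] _ //= _;
    by rewrite /K/= in_itv//= overlapC.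
apply/eqP; rewrite eq_le measure_ge0 andbT leNgt; apply/negP => cell_gt0.
have col3 : (0 < Q (col 3%N))%E.
  by apply: lt_le_trans cell_gt0 _; apply: le_measure; rewrite ?inE//; exact: measurable_cell.
have coln n : (2 < n)%N -> (0 < Q (col n))%E.
  elim: n => // n IH; rewrite ltnS leq_eqVlt => /predU1P[<-//|n2].
  apply: (colored_extend norm_dot sepH GG mK KC K_lt K_diag (p := (n - 3)%N)).
  - by rewrite ltnW.
  - lia.
  - by rewrite /color_of -{1}(subnK n2) modnDr.
  - exact: IH.
(* With [m > 4 / ((b - a)^2 - 2 e)] the conclusion of [clusters_gap] fails. *)
pose m := (Num.truncn (4 / ((b - a) ^+ 2 - 2 * e))).+1.
have m_gt2 : (2 < 3 * m)%N by rewrite /m; lia.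
have [s cols balls] := replica_law_gt0_balls (3 * m) (mcol _) (coln _ m_gt2).
pose u i (k : 'I_m) : H := s (3 * k + i)%N.
have u1 i k : (i < 3)%N -> `|u i k| <= 1.
  by move=> i3; apply: balls; have := ltn_ord k; lia.
have colu i j (k l : 'I_m) : (i < 3)%N -> (j < 3)%N -> (3 * k + i != 3 * l + j)%N ->
    K (color_of i) (color_of j) (dot (u i k) (u j l)).
  move=> i3 j3; rewrite -(color_ofMD k i) -(color_ofMD l j); have := ltn_ord k.
  by have := ltn_ord l => lm km; apply: (cols (3 * k + i)%N _ (3 * l + j)%N); lia.
suff : m%:R * (b - a) ^+ 2 <= 4 + 2 * e * m%:R.
  apply/negP; rewrite -ltNge -ltrBrDr mulrC -mulrBl.
  rewrite -ltr_pdivrMl; last by lra.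
  by rewrite mulrC; exact: real_truncnS_gt (num_real _).
apply: (@clusters_gap R H dot norm_dot m (u 0) (u 1) (u 2) a b c e isT ab).
- by move=> k; exact: u1.
- by move=> k; exact: u1.
- by move=> k; exact: u1.
- move=> k l; have := @colu 0 1 k l isT isT; rewrite /K/= in_itv/= => /(_ _)/ltW; apply; lia.
- move=> k l; have := @colu 0 2 k l isT isT; rewrite /K/= in_itv/= => /(_ _)/andP[|//]; lia.
- move=> k l; have := @colu 1 2 k l isT isT; rewrite /K/= in_itv/= => /(_ _)/andP[|? /ltW->]; [lia|exact/andP].
- move=> k l kl; have := @colu 1 1 k l isT isT; rewrite /K/= in_itv/= => /(_ _)/ltW; apply.
  move: kl; rewrite -val_eqE/=; lia.
- move=> k l kl; have := @colu 2 2 k l isT isT; rewrite /K/= in_itv/= => /(_ _)/ltW; apply.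
  move: kl; rewrite -val_eqE/=; lia.
Qed.

Lemma measurable_overlap_lt i j k l :
  measurable [set s : S | overlap dot s i j < overlap dot s k l].
Proof.
rewrite (_ : mkset _ = (fun s : S => overlap dot s k l - overlap dot s i j) @^-1`
    `]0, +oo[%classic).
  rewrite -[X in measurable X]setTI; by apply: measurable_funB => //; exact: measurable_overlap.
by apply/seteqP; split => s; rewrite /preimage/= in_itv/= andbT subr_gt0.
Qed.

Lemma measurable_overlap_le i j k l :
  measurable [set s : S | overlap dot s i j <= overlap dot s k l].
Proof.
rewrite (_ : mkset _ = ~` [set s : S | overlap dot s k l < overlap dot s i j]).
  by apply: measurableC; exact: measurable_overlap_lt.
by apply/seteqP; split => s /=; rewrite leNgt => /negP.
Qed.

(** The event is covered by countably many null cells, taken from grids of mesh [e k] with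
    separation [delta k] between [a] and [b]. *)
Lemma ordered_violation_null : Q ([set s : S | overlap dot s 0 1 < overlap dot s 0 2] `&`
  [set s : S | overlap dot s 0 2 <= overlap dot s 1 2]) = 0%E.
Proof.
(* The factor 8 ensures both [2 * e k < delta k ^+ 2], as [cell_null] requires, and
   [e k <= delta k]. *)
pose delta k : R := k.+1%:R^-1; pose e k := delta k ^+ 2 / 8.
pose grid k (i j : int) :=
  cell (i%:~R * e k - delta k) (i%:~R * e k) (j%:~R * e k) (e k).
have delta_gt0 k : 0 < delta k by rewrite invr_gt0.
have e_gt0 k : 0 < e k by rewrite divr_gt0// exprn_gt0.
(* The cells are enumerated by codes of triples; codes of no triple, or with [i > j], give the empty
   set. *)
pose F n := if (unpickle n : option (nat * int * int)) is Some (k, i, j) then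
  if (i <= j)%R then grid k i j else set0 else set0.
apply: measure_negligible.
  by apply: measurableI; [exact: measurable_overlap_lt|exact: measurable_overlap_le].
apply: (@negligibleS _ _ _ _ (\bigcup_n F n)); last first.
  apply: negligible_bigcup => n; rewrite /F.
  case: unpickle => [[[k i] j]|]; last exact: negligible_set0.
  case: leP => [ij|_]; last exact: negligible_set0.
  apply/negligibleP; first exact: measurable_cell.
  apply: cell_null => //.
  - by rewrite gerBl ltW.
  - by rewrite ler_wpM2r ?ler_int// ltW.
  - by rewrite subKr /e; have := exprn_gt0 2 (delta_gt0 k); lra.
move=> s [/= lt01 le02].
have gap : 0 < (overlap dot s 0 2 - overlap dot s 0 1) / 2.
  by rewrite divr_gt0// subr_gt0.
(* The gap between the two overlaps exceeds [2 * delta k]: rounding the larger one down to the grid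
   loses less than [e k <= delta k], which leaves the separation [delta k]. *)
have [k] := ltr_add_invr gap; rewrite add0r -/(delta k) => k_gap.
pose cellof x := Num.floor (x / e k).
have cellofP x : (cellof x)%:~R * e k <= x < (cellof x)%:~R * e k + e k.
  rewrite -[X in _ < _ + X]mul1r -mulrDl -ler_pdivlMr// floor_le/= -ltr_pdivrMr//.
  by have := floorD1_gt (x / e k); rewrite intrD.
exists (pickle (k, cellof (overlap dot s 0 2), cellof (overlap dot s 1 2))) => //.
rewrite /F pickleK ifT; last first.
  by rewrite le_floor// ler_wpM2r// invr_ge0 ltW.
split; [|exact: cellofP|exact: cellofP].
have /andP[_ lt2] := cellofP (overlap dot s 0 2).
have e_delta : e k <= delta k.
  rewrite /e ler_pdivrMr// expr2 ler_wpM2l ?(ltW (delta_gt0 k))//.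
  by rewrite (@le_trans _ _ 1)// ?ler1n// /delta invf_le1// ler1n.
lra.
Qed.

Lemma measurable_violation : measurable [set s : S |
  overlap dot s 0 1 < Num.min (overlap dot s 0 2) (overlap dot s 1 2)].
Proof.
rewrite (_ : mkset _ = [set s : S | overlap dot s 0 1 < overlap dot s 0 2] `&`
    [set s : S | overlap dot s 0 1 < overlap dot s 1 2]).
  by apply: measurableI; exact: measurable_overlap_lt.
by apply/seteqP; split => s /=; rewrite lt_min => /andP.
Qed.

(** Exchanging the first two replicas swaps the overlaps [0 2] and [1 2] and fixes [0 1], so either
    one may be assumed to be the smaller. *)
Lemma violation_null : Q [set s : S |
  overlap dot s 0 1 < Num.min (overlap dot s 0 2) (overlap dot s 1 2)] = 0%E.
Proof.
pose V : set S := [set s : S | overlap dot s 0 1 < overlap dot s 0 2] `&`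
  [set s : S | overlap dot s 0 2 <= overlap dot s 1 2].
have mV : measurable V.
  by apply: measurableI; [exact: measurable_overlap_lt|exact: measurable_overlap_le].
have V0 : Q V = 0%E by exact: ordered_violation_null.
have mV' := measurable_preimage_reindex (transp 0 1) mV.
have V'0 : Q (reindex (transp 0 1) @^-1` V) = 0%E by rewrite replica_law_transp.
rewrite (_ : mkset _ = V `|` reindex (transp 0 1) @^-1` V).
  by rewrite measureU0.
rewrite /V preimage_setI /preimage/= /overlap /reindex /transp /=.
apply/seteqP; split => s; rewrite /= lt_min (dotC dot (s 1%N) (s 0%N)).
  move=> /andP[lt02 lt12].
  by have [le02|/ltW le12] := leP (dot (s 0%N) (s 2%N)) (dot (s 1%N) (s 2%N)); [left|right].
by case=> -[lt le]; rewrite lt/= ?(lt_le_trans lt le).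
Qed.

End ultrametricity.

Theorem theorem1 (R : realType)
    (H : completeNormedModType R) (dot : {dot H for idfun})
    (norm_dot : forall x : H, `|x| ^+ 2 = dot x x)
    (sepH : separable H)
    (d : measure_display) (Omega : measurableType d) (P : probability Omega R)
    (G : {mfun Omega >-> pprobability (borel H) R})
    (G_ball : forall w, (G w : probability (borel H) R) [set x | `|x| <= 1] = 1%E)
    (GG : ghirlanda_guerra P dot G) :
  replica_avg P G (\1_[set s : nat -> H |
    overlap dot s 0 1 >= Num.min (overlap dot s 0 2) (overlap dot s 1 2)]) = 1.
Proof.
set A := (X in \1_X).
have AC : A = ~` [set s : seqspace (borel H) | overlap dot s 0 1 <
    Num.min (overlap dot s 0 2) (overlap dot s 1 2)].
  by apply/seteqP; split => s /=; rewrite /A/= leNgt => /negP.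
have mC : measurable [set s : seqspace (borel H) | overlap dot s 0 1 <
    Num.min (overlap dot s 0 2) (overlap dot s 1 2)].
  exact: measurable_violation.
rewrite AC replica_avg_indic; last exact: measurableC.
by rewrite probability_setC// [X in (_ - X)%E]violation_null// sube0.
Qed.
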